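(* Let $G$ be a finite connected regularly diagonal directed graph, i.e. $\mathrm{EMH}_{k,\ell}(G)=0$ for all $k\neq\ell$. Then the regular path homology groups of $G$ are isomorphic to the homology groups of the complex of injective words on $G$: $H_k(\Omega^\iota_*(G),\partial)\cong H_k(\mathrm{Inj}(G);R)$ for all $k\geq 0$.
   Context: $R$ is a fixed commutative unital ring. A directed graph $G$ has vertex set $V(G)$ and edge set $E(G)\subseteq V(G)\times V(G)$; connected means connected as an undirected graph. $d_G(x,y)$ is the minimal length of a directed path from $x$ to $y$ ($\infty$ if there is none), and $\mathrm{len}(x_0,\dots,x_k)=\sum_{i=0}^{k-1}d_G(x_i,x_{i+1})$ when all terms are finite. Eulerian magnitude homology: $\mathrm{EMC}_{k,\ell}(G)$ is the free $R$-module on tuples $(x_0,\dots,x_k)$ of pairwise distinct vertices with $d_G(x_i,x_{i+1})<\infty$ for all $i$ and length $\ell$; $\partial=\sum_{i=1}^{k-1}(-1)^i\partial_i$, where $\partial_i$ deletes $x_i$ if the resulting tuple still has length $\ell$ and is $0$ otherwise; $\mathrm{EMH}_{k,\ell}(G)=H_k(\mathrm{EMC}_{*,\ell}(G),\partial)$. Regular path homology: let $\Lambda_n(G)$ be the free $R$-module on all $(n+1)$-tuples of vertices, with $\partial=\sum_{i=0}^n(-1)^i(\text{delete the } i\text{-th entry})$ (and $\partial=0$ for $n=0$). A tuple $(x_0,\dots,x_n)$ is allowed if $(x_i,x_{i+1})\in E(G)$ for all $i$, and strongly regular if its entries are pairwise distinct. Let $\mathcal{A}^\iota_n(G)\subseteq\Lambda_n(G)$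 be spanned by the strongly regular allowed tuples, and $\Omega^\iota_n(G)=\{v\in\mathcal{A}^\iota_n(G)\mid \partial v\in\mathcal{A}^\iota_{n-1}(G)\}$ (with $\Omega^\iota_0=\mathcal{A}^\iota_0$). The regular path homology groups are the homology groups of $(\Omega^\iota_*(G),\partial)$. Complex of injective words: $\mathrm{Inj}(G)$ is the complex (ordered simplicial complex, i.e. semi-simplicial set) whose $p$-simplices are the words $x_0\cdots x_p$ of pairwise distinct vertices of $G$ such that for all $i<j$ there is a directed path in $G$ from $x_i$ to $x_j$, with faces given by deleting letters. *)

(* Defs.v *)
From HB Require Import structures.
From mathcomp Require Import all_boot all_algebra.
From mathcomp Require Import boolp.

Set Implicit Arguments.
Unset Strict Implicit.
Unset Printing Implicit Defensive.

Import GRing.Theory.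
Local Open Scope ring_scope.
Local Open Scope quotient_scope.

Section Submodule.
Variables (R : pzRingType) (M : lmodType R).

Record submod (S : {pred M}) := Submod { submod_val : M; _ : submod_val \in S }.

HB.instance Definition _ (S : {pred M}) := [isSub for @submod_val S].
HB.instance Definition _ (S : {pred M}) := [Choice of submod S by <:].
HB.instance Definition _ (S : submodClosed M) :=
  [SubChoice_isSubLmodule of submod S by <:].

End Submodule.

Section QuotientModule.
Variables (R : pzRingType) (M : lmodType R) (B : submodClosed M).

(* A submodClosed predicate is not canonically zmodClosed, which is what
   ring_quotient's Quotient.quot expects. *)
Definition submod_pred : {pred M} := fun x => x \in B.
HB.instance Definition _ := GRing.isZmodClosed.Build M submod_pred
  (GRing.subsemimod_closedB (GRing.subsemimodClosedP B)).

Definition quotmod := Quotient.quot submod_pred.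

HB.instance Definition _ := GRing.Zmodule.on quotmod.
HB.instance Definition _ := EqQuotient.on quotmod.

Definition quotmod_scale (a : R) : quotmod -> quotmod :=
  lift_op1 quotmod ( *:%R a).

Lemma pi_quotmod_scale a :
  {morph \pi_quotmod : x / a *: x >-> quotmod_scale a x}.
Proof.
move=> x; rewrite /quotmod_scale; unlock; apply/eqP.
rewrite -Quotient.idealrBE -scalerBr unfold_in rpredZ //.
rewrite -[_ \in B]/(_ \in submod_pred); by rewrite Quotient.idealrBE reprK.
Qed.

Lemma pi_quotmodD : {morph \pi_quotmod : x y / x + y >-> x + y}.
Proof. exact: Quotient.pi_add. Qed.

Fact quotmod_scalerA a b v :
  quotmod_scale a (quotmod_scale b v) = quotmod_scale (a * b) v.
Proof. by rewrite -[v]reprK -!pi_quotmod_scale scalerA. Qed.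

Fact quotmod_scale1r : left_id 1 quotmod_scale.
Proof. by move=> v; rewrite -[v]reprK -pi_quotmod_scale scale1r. Qed.

Fact quotmod_scalerDr : right_distributive quotmod_scale +%R.
Proof.
move=> a u v; rewrite -[u]reprK -[v]reprK -pi_quotmodD -!pi_quotmod_scale.
by rewrite -pi_quotmodD scalerDr.
Qed.

Fact quotmod_scalerDl v : {morph quotmod_scale^~ v : a b / a + b}.
Proof.
by move=> a b; rewrite -[v]reprK -!pi_quotmod_scale -pi_quotmodD scalerDl.
Qed.

HB.instance Definition _ := GRing.Zmodule_isLmodule.Build R quotmod
  quotmod_scalerA quotmod_scale1r quotmod_scalerDr quotmod_scalerDl.

Fact pi_quotmod_is_linear : linear (\pi_quotmod : M -> quotmod).
Proof. by move=> a u v; rewrite pi_quotmodD pi_quotmod_scale. Qed.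

End QuotientModule.

Definition lmod_isomorphic (R : pzRingType) (M N : lmodType R) : Prop :=
  exists f : {linear M -> N}, bijective f.

Record chain_complex (R : pzRingType) := ChainComplex {
  chain :> nat -> lmodType R;
  bdry : forall n, {linear chain n.+1 -> chain n};
  bdry_bdry : forall n c, bdry n (bdry n.+1 c) = 0
}.

Section Homology.
Variables (R : pzRingType) (C : chain_complex R) (n : nat).

Definition is_cycle : {pred C n} :=
  match n return {pred C n} with
  | 0 => fun _ => true
  | m.+1 => fun c => bdry C m c == 0
  end.

Fact is_cycle_submod : submod_closed is_cycle.
Proof.
rewrite /is_cycle; case: n => [|m]; split; rewrite ?unfold_in ?linear0 //.
by move=> a u v; rewrite !unfold_in linearP => /eqP-> /eqP->; rewrite scaler0 addr0.
Qed.
HB.instance Definition _ :=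
  GRing.isSubmodClosed.Build R (C n) is_cycle is_cycle_submod.

Definition cycles : lmodType R := submod is_cycle.

Definition is_boundary : {pred cycles} :=
  fun z => `[< exists c : C n.+1, bdry C n c = val z >].

Fact is_boundary_submod : submod_closed is_boundary.
Proof.
split=> [|a u v]; rewrite !unfold_in.
  by apply/asboolP; exists 0; rewrite !linear0.
move=> /asboolP[c cE] /asboolP[d dE]; apply/asboolP; exists (a *: c + d).
by rewrite !linearP /= cE dE.
Qed.
HB.instance Definition _ :=
  GRing.isSubmodClosed.Build R cycles is_boundary is_boundary_submod.

Definition homology : lmodType R := quotmod is_boundary.

End Homology.

Section FreeModule.
Variable R : comPzRingType.

Definition free_mod (T : finType) : lmodType R := {ffun T -> R^o}.

Definition basis (T : finType) (x : T) : free_mod T := [ffun y => (y == x)%:R].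

Definition basis_or0 (T : finType) (o : option T) : free_mod T :=
  if o is Some x then basis x else 0.

Definition lin_ext (T : finType) (M : lmodType R) (f : T -> M) (v : free_mod T) : M :=
  \sum_x v x *: f x.

Fact lin_ext_is_linear (T : finType) (M : lmodType R) (f : T -> M) : linear (lin_ext f).
Proof.
move=> a u v; rewrite /lin_ext scaler_sumr -big_split; apply: eq_bigr => x _.
by rewrite !ffunE scalerDl scalerA.
Qed.
HB.instance Definition _ (T : finType) (M : lmodType R) (f : T -> M) :=
  GRing.isLinear.Build R (free_mod T) M *:%R (lin_ext f) (lin_ext_is_linear f).

Lemma lin_ext_basis (T : finType) (M : lmodType R) (f : T -> M) x : lin_ext f (basis x) = f x.
Proof.
rewrite /lin_ext (bigD1 x) //= big1 => [|y /negPf yx]; rewrite ffunE.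
  by rewrite eqxx scale1r addr0.
by rewrite yx scale0r.
Qed.

Definition span_of (T : finType) (P : pred T) : {pred free_mod T} :=
  fun v => `[< exists c : T -> R, v = \sum_(x | P x) c x *: basis x >].

Lemma span_ofP (T : finType) (P : pred T) (v : free_mod T) :
  reflect (forall x, ~~ P x -> v x = 0) (v \in span_of P).
Proof.
apply: (iffP (asboolP _)) => [[c ->] x nPx | v0].
  rewrite sum_ffunE big1 // => y Py; rewrite !ffunE.
  by case: eqP => [E|_]; [rewrite E Py in nPx | rewrite scaler0].
exists v; apply/ffunP => x; rewrite sum_ffunE.
have [Px|nPx] := boolP (P x).
  rewrite (bigD1 x) //= big1 => [|y /andP[_ yx]]; rewrite !ffunE.
    by rewrite eqxx addr0 [RHS]mulr1.
  by rewrite eq_sym (negPf yx) scaler0.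
rewrite big1 ?v0 // => y Py; rewrite !ffunE.
by case: eqP => [E|_]; [rewrite E Py in nPx | rewrite scaler0].
Qed.

Fact span_of_submod (T : finType) (P : pred T) : submod_closed (span_of P).
Proof.
split=> [|a u v /span_ofP u0 /span_ofP v0]; apply/span_ofP => x nPx.
  by rewrite ffunE.
by rewrite !ffunE u0 // v0 // scaler0 addr0.
Qed.
HB.instance Definition _ (T : finType) (P : pred T) :=
  GRing.isSubmodClosed.Build R (free_mod T) (span_of P) (span_of_submod P).

(* Cells T n in degree n; [face n i] deletes the i-th entry of a cell of degree
   n.+1 and is None when that face counts as 0; the boundary only involves the
   indices i such that I n i. *)
Section Alternating.
Variables (T : nat -> finType) (I : forall n, pred 'I_n.+2).
Variable face : forall n, 'I_n.+2 -> T n.+1 -> option (T n).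

Definition alt_bdry n : free_mod (T n.+1) -> free_mod (T n) :=
  lin_ext (fun x =>
    \sum_(i < n.+2 | I i) (-1) ^+ i *: basis_or0 (face i x)).
HB.instance Definition _ n := GRing.Linear.on (@alt_bdry n).

Definition rface n (i : 'I_n.+2) x := if I i then face i x else None.

Definition presimplicial :=
  forall n (i j : nat) (x : T n.+2), (i <= j < n.+2)%N ->
    obind (rface (inord j)) (rface (inord i) x)
    = obind (rface (inord i)) (rface (inord j.+1) x).

Lemma alt_bdryE n x :
  alt_bdry (basis x)
  = \sum_(i < n.+2) (-1) ^+ i *: basis_or0 (rface i x).
Proof.
rewrite /alt_bdry lin_ext_basis big_mkcond; apply: eq_bigr => i _.
by rewrite /rface; case: ifP; rewrite //= scaler0.
Qed.

Lemma alt_sum0 (M : lmodType R) m (F : nat -> nat -> M) :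
    (forall i j, (i <= j < m)%N -> F i j = F j.+1 i) ->
  \sum_(i < m.+1) \sum_(j < m) (-1) ^+ (i + j) *: F i j = 0.
Proof.
move=> FE.
pose G i j : M := (-1) ^+ (i + j) *: F i j.
under eq_bigr => i _ do rewrite (bigID (fun j : 'I_m => i <= j)%N) /=.
rewrite big_split /= big_ord_recr /= [X in _ + X + _]big1 ?addr0; last first.
  by move=> j; rewrite leqNgt ltn_ord.
rewrite [X in _ + X]big_ord_recl /= [X in _ + (X + _)]big1 ?add0r; last first.
  by [] || by move=> j.
rewrite [X in X + _](exchange_big_dep predT) //= -big_split big1 //= => i _.
under [X in _ + X]eq_bigl => j do rewrite -ltnNge /bump leq0n add1n ltnS.
rewrite -big_split big1 //= => j ji.
rewrite FE ?ji ?ltn_ord // /bump leq0n add1n addSn exprS mulN1r scaleNr.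
by rewrite [(j + i)%N]addnC subrr.
Qed.

Lemma alt_bdry_bdry : presimplicial ->
  forall n (v : free_mod (T n.+2)), alt_bdry (alt_bdry v) = 0.
Proof.
move=> simp n v.
have -> : alt_bdry v = \sum_x v x *: alt_bdry (basis x).
  by apply: eq_bigr => x _; rewrite /alt_bdry lin_ext_basis.
rewrite [LHS]linear_sum big1 // => x _; rewrite [LHS]linearZ /=.
suff -> : alt_bdry (alt_bdry (basis x)) = 0 by rewrite scaler0.
rewrite alt_bdryE [LHS]linear_sum.
pose F (i j : nat) : free_mod (T n) :=
  basis_or0 (obind (rface (inord j : 'I_n.+2)) (rface (inord i : 'I_n.+3) x)).
rewrite -[RHS](@alt_sum0 _ n.+2 F) => [|i j ij]; last by rewrite /F simp.
apply: eq_bigr => i _; rewrite [LHS]linearZ /= /F inord_val.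
case: (rface i x) => [y|] /=; last first.
  by rewrite linear0 scaler0 big1 // => j _; rewrite scaler0.
rewrite alt_bdryE scaler_sumr; apply: eq_bigr => j _.
by rewrite scalerA exprD inord_val.
Qed.

Definition alt_complex (simp : presimplicial) : chain_complex R :=
  @ChainComplex R (fun n => free_mod (T n)) (fun n => @alt_bdry n)
    (alt_bdry_bdry simp).

End Alternating.
End FreeModule.

Section Deletion.
Variable V : finType.

Definition del n (i : 'I_n.+2) (t : n.+2.-tuple V) : n.+1.-tuple V :=
  [tuple tnth t (lift i j) | j < n.+1].

Lemma del_del n (i j : nat) (t : n.+3.-tuple V) : (i <= j < n.+2)%N ->
  del (inord j) (del (inord i) t) = del (inord i) (del (inord j.+1) t).
Proof.
case/andP=> ij jn; apply: eq_from_tnth => k; rewrite !tnth_mktuple.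
congr tnth; apply: val_inj => /=.
have im : (i < n.+2)%N by exact: leq_ltn_trans jn.
have im' : (i < n.+3)%N by exact: ltnW.
rewrite !inordK // bumpC.
by congr (bump _ (bump _ _)); rewrite /bump /unbump ?ij // ltnNge ij subn0.
Qed.

(* Cells are the tuples satisfying P; a face that does not satisfy P is 0. *)
Section TupleCells.
Variable P : forall n, pred (n.+1.-tuple V).

Definition cell n : finType := {t : n.+1.-tuple V | P t}.

Definition cell_face n (i : 'I_n.+2) (x : cell n.+1) : option (cell n) :=
  insub (del i (val x)).

Definition del_convex := forall n (t : n.+3.-tuple V) i j,
  P t -> P (del j (del i t)) -> P (del i t).

Definition all_idx n : pred 'I_n.+2 := fun _ => true.
(* For a cell of degree k = n.+1, the indices 1 <= i <= k-1. *)
Definition interior_idx n : pred 'I_n.+2 := fun i => (0 < i < n.+1)%N.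

Lemma obind_cell_face n (x : cell n.+2) i j : del_convex ->
  obind (@cell_face n j) (cell_face i x) = insub (del j (del i (val x))).
Proof.
move=> conv; rewrite /cell_face; case: insubP => [y _ yE|nP] /=.
  by rewrite yE.
rewrite insubF //; apply: contraNF nP; apply: conv; exact: valP.
Qed.

Lemma cell_presimplicial_all : del_convex -> presimplicial all_idx cell_face.
Proof.
move=> conv n i j x ij; rewrite /rface /=.
by rewrite !(obind_cell_face _ _ _ conv) del_del.
Qed.

Lemma cell_presimplicial_interior :
  del_convex -> presimplicial interior_idx cell_face.
Proof.
move=> conv n i j x /[dup] ij' /andP[ij jn]; rewrite /rface /interior_idx.
have ein : (i < n.+2)%N by apply: leq_ltn_trans jn.
rewrite !inordK ?ltnS //; last by apply: ltnW.
case: i ij ij' ein => [|i] ij ij' ein /=; first by case: ifP => //= _; case: cell_face.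
have j_gt0 : (0 < j)%N by exact: leq_trans ij.
rewrite j_gt0 /=; case: (leqP j n) => jn'; last first.
  by case: ifP => //= _; case: cell_face.
have in' : (i < n)%N by exact: leq_trans jn'.
rewrite in' (ltnW in' : i < n.+1)%N /=.
by rewrite !(obind_cell_face _ _ _ conv) del_del.
Qed.

End TupleCells.
End Deletion.

Section Digraph.
Variables (V : finType) (E : rel V).

Definition connected_digraph : Prop :=
  forall x y, connect (fun u v => E u v || E v u) x y.

Definition walk n (x y : V) : bool :=
  [exists p : n.-tuple V, path E x p && (last x p == y)].

Lemma walkP n x y :
  reflect (exists2 p, size p = n & path E x p /\ last x p = y) (walk n x y).
Proof.
apply: (iffP existsP) => [[p /andP[xp /eqP yE]]|[p /eqP pn [xp /eqP yE]]].
  by exists p; rewrite ?size_tuple.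
by exists (Tuple pn); rewrite /= xp.
Qed.

Fact connect_walk x y : connect E x y -> exists n, walk n x y.
Proof.
by move=> /connectP[p xp yE]; exists (size p); apply/walkP; exists p.
Qed.

(* None stands for an infinite distance or length. *)
Definition dist (x y : V) : option nat :=
  if @idP (connect E x y) is ReflectT xy then Some (ex_minn (connect_walk xy))
  else None.

Fixpoint len (s : seq V) : option nat :=
  match s with
  | x :: (y :: _) as s' =>
      if (dist x y, len s') is (Some a, Some b) then Some (a + b)%N else None
  | _ => Some 0
  end.

Lemma distP x y d :
  dist x y = Some d <-> walk d x y /\ (forall n, walk n x y -> (d <= n)%N).
Proof.
rewrite /dist; case: {-}_ / idP => [xy|nxy].
  case: ex_minnP => m wm mmin; split=> [[<-]//|[wd dmin]].
  by congr Some; apply/eqP; rewrite eqn_leq mmin // dmin.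
split=> // -[/walkP[p _ [xp yE]] _]; case: nxy.
by apply/connectP; exists p.
Qed.

Lemma dist_walk n x y : walk n x y -> exists2 d, dist x y = Some d & (d <= n)%N.
Proof.
move=> w; have [d wd dmin] : exists2 d, walk d x y & forall m, walk m x y -> (d <= m)%N.
  have ex : exists m, walk m x y by exists n.
  by case: (ex_minnP ex) => d; exists d.
by exists d; [apply/distP | apply: dmin].
Qed.

Lemma dist_triangle x y z a b : dist x y = Some a -> dist y z = Some b ->
  exists2 c, dist x z = Some c & (c <= a + b)%N.
Proof.
move=> /distP[/walkP[p pa [xp yE]] _] /distP[/walkP[q qb [yq zE]] _].
apply: dist_walk; apply/walkP; exists (p ++ q).
  by rewrite size_cat pa qb.
by rewrite cat_path last_cat xp yE yq.
Qed.

Definition rm (i : nat) (s : seq V) := take i s ++ drop i.+1 s.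

Lemma val_del n (i : 'I_n.+2) (t : n.+2.-tuple V) : val (del i t) = rm i t.
Proof.
have x0 : V := thead t.
have si : size (rm i t) = n.+1.
  rewrite size_cat size_take size_drop size_tuple ltn_ord subSS.
  by rewrite subnKC // -ltnS.
apply: (@eq_from_nth _ x0) => [|k]; first by rewrite si size_tuple.
rewrite size_tuple => kn.
rewrite -[in LHS](@tnth_nth _ _ x0 (del i t) (Ordinal kn)) tnth_mktuple.
rewrite (tnth_nth x0) /= nth_cat size_take size_tuple ltn_ord /bump.
case: (ltnP k i) => ki; first by rewrite nth_take.
by rewrite nth_drop addSn subnKC.
Qed.

Lemma len_cons x y s l : len [:: x, y & s] = Some l ->
  exists a b, [/\ dist x y = Some a, len (y :: s) = Some b & l = (a + b)%N].
Proof.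
change (len [:: x, y & s]) with (if (dist x y, len (y :: s)) is (Some a, Some b)
  then Some (a + b)%N else None).
by case: (dist x y) (len _) => [a|] [b|] // [<-]; exists a, b.
Qed.

Lemma len_rm i (s : seq V) l :
  len s = Some l -> exists2 m, len (rm i s) = Some m & (m <= l)%N.
Proof.
elim: i s l => [|i IH] [|x s] l; rewrite /rm.
- by move=> [<-]; exists 0.
- rewrite take0 drop1 /=; case: s => [|y s] //; first by exists 0.
  case: dist => // a; case: (len _) => // b [<-].
  by exists b => //; apply: leq_addl.
- by move=> [<-]; exists 0.
case: s => [|y s]; first by move=> [<-]; exists 0.
move=> /len_cons[a [b [xy ys ->]]].
case: i IH => [|i] IH.
  rewrite /= drop0; case: s ys => [_|z s]; first by exists 0.
  move=> /len_cons[c [d [yz zs ->]]]; move: zs => /= ->.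
  have [e -> ec] := dist_triangle xy yz.
  by exists (e + d)%N; rewrite // addnA leq_add2r.
have [m mE mb] := IH _ _ ys.
have -> : take i.+2 (x :: y :: s) ++ drop i.+3 (x :: y :: s)
  = x :: y :: rm i s by [].
rewrite -[y :: rm i s]/(rm i.+1 (y :: s)).
move: mE; rewrite /= xy => ->.
by exists (a + m)%N => //; rewrite leq_add2l.
Qed.

Lemma subseq_rm i (s : seq V) : subseq (rm i s) s.
Proof.
rewrite -[X in subseq _ X](cat_take_drop i s) /rm cat_subseq //.
by rewrite -[i.+1]add1n -drop_drop drop_subseq.
Qed.

End Digraph.

Section Theories.
Variables (R : comPzRingType) (V : finType) (E : rel V).

Definition emc_cell l n (t : n.+1.-tuple V) : bool :=
  uniq t && (len E t == Some l).

(* Deleting an inner entry keeps the entries distinct and, by the triangle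
   inequality, the distances finite: such a face fails emc_cell l, and so counts
   as 0 in EMC l, exactly when its length is not l. *)
Fact emc_convex l : del_convex (emc_cell l).
Proof.
move=> n t i j /andP[ut /eqP lt] /andP[_]; rewrite /emc_cell !val_del.
have [m lm ml] := len_rm i lt; have [k -> km] := len_rm j lm.
rewrite (subseq_uniq (subseq_rm i t) ut) lm => /eqP[kl] /=.
by apply/eqP; congr Some; apply/eqP; rewrite eqn_leq ml -kl.
Qed.

Definition EMC l : chain_complex R :=
  alt_complex R (cell_presimplicial_interior (emc_convex (l := l))).

Definition EMH k l : lmodType R := homology (EMC l) k.

Definition regularly_diagonal : Prop :=
  forall k l, k <> l -> forall h : EMH k l, h = 0.

Fact tuple_presimplicial :
  presimplicial (@all_idx) (fun n (i : 'I_n.+2) (t : n.+2.-tuple V) => Some (del i t)).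
Proof. by move=> n i j t ij; rewrite /rface /= del_del. Qed.

Definition Lambda : chain_complex R := alt_complex R tuple_presimplicial.

Definition strongly_regular_allowed n (t : n.+1.-tuple V) : bool :=
  uniq t && sorted E t.

Definition A_reg n : {pred Lambda n} := span_of (@strongly_regular_allowed n).

Definition Omega_reg n : {pred Lambda n} :=
  match n return {pred Lambda n} with
  | 0 => @A_reg 0
  | m.+1 => fun v => (v \in @A_reg m.+1) && (bdry Lambda m v \in @A_reg m)
  end.

Fact Omega_reg_submod n : submod_closed (@Omega_reg n).
Proof.
have A_sub m : submod_closed (@A_reg m) by exact: span_of_submod.
case: n => [|n]; first exact: A_sub.
split=> [|a u v /andP[Au Adu] /andP[Av Adv]]; rewrite unfold_in.
  by rewrite linear0 !(A_sub _).1.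
by rewrite linearP !(A_sub _).2.
Qed.
HB.instance Definition _ n := GRing.isSubmodClosed.Build R (Lambda n)
  (@Omega_reg n) (@Omega_reg_submod n).

Definition Omega n : lmodType R := submod (@Omega_reg n).

Fact Omega_bdry_in n (v : Omega n.+1) : bdry Lambda n (val v) \in @Omega_reg n.
Proof.
case/andP: (valP v) => _; case: n v => [|n] v // Adv.
rewrite unfold_in Adv bdry_bdry; exact: (@span_of_submod _ _ _).1.
Qed.

Definition Omega_bdry n (v : Omega n.+1) : Omega n := Submod (Omega_bdry_in v).

Fact Omega_bdry_is_linear n : linear (@Omega_bdry n).
Proof.
move=> a u v; apply: val_inj; rewrite [RHS]linearP.
by rewrite -[LHS]/(bdry Lambda n (val (a *: u + v))) !linearP.
Qed.
HB.instance Definition _ n := GRing.isLinear.Build R (Omega n.+1) (Omega n)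
  *:%R (@Omega_bdry n) (@Omega_bdry_is_linear n).

Fact Omega_bdry_bdry n (v : Omega n.+2) : Omega_bdry (Omega_bdry v) = 0.
Proof. by apply: val_inj; rewrite linear0; apply: bdry_bdry. Qed.

Definition Omega_complex : chain_complex R :=
  @ChainComplex R Omega (fun n => @Omega_bdry n) Omega_bdry_bdry.

Definition inj_word n (t : n.+1.-tuple V) : bool :=
  uniq t && pairwise (connect E) t.

Fact inj_word_convex : del_convex inj_word.
Proof.
move=> n t i j /andP[ut ct] _; rewrite /inj_word val_del.
by rewrite (subseq_uniq (subseq_rm i t) ut) (subseq_pairwise (subseq_rm i t) ct).
Qed.

(* Every face of an injective word is one, so no face is discarded here. *)
Definition Inj_complex : chain_complex R :=
  alt_complex R (cell_presimplicial_all inj_word_convex).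

End Theories.

(* Main.v *)
(** Filter Inj(G) by length.  Deleting an end letter of an injective word
strictly shortens it, so the graded piece of length l is EMC_{*,l}(G), whose
homology vanishes outside degree l.  In degree n every injective word has length
at least n, with equality exactly for the allowed ones, so Omega_n consists of
the chains of length at most n whose boundary has length at most n - 1.
Vanishing of EMH_{n,l} for l > n lets one subtract boundaries from a chain whose
boundary is already short until it lies in Omega_n; applied to cycles this gives
surjectivity, and applied to bounding chains injectivity, of
H(Omega) -> H(Inj). *)
Require Import Defs.
From mathcomp Require Import all_boot all_algebra.
From HB Require Import structures.
From mathcomp Require Import boolp.

Set Implicit Arguments.
Unset Strict Implicit.
Unset Printing Implicit Defensive.

Import GRing.Theory.
Local Open Scope ring_scope.
Local Open Scope quotient_scope.

(** * Quotient modules and maps induced on homology *)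

Section Quotient.
Variables (R : pzRingType) (M : lmodType R) (B : submodClosed M).

Lemma pi_quotmod_eq (x y : M) :
  (\pi_(quotmod B) x == \pi_(quotmod B) y) = (x - y \in B).
Proof. by rewrite -Quotient.idealrBE. Qed.

Lemma repr_quotmodB (x : M) : repr (\pi_(quotmod B) x) - x \in B.
Proof. by rewrite -pi_quotmod_eq reprK. Qed.

End Quotient.

Section QuasiIsomorphism.
Variables (R : pzRingType) (C D : chain_complex R) (n : nat).
Variable f : forall m, {linear C m -> D m}.
Hypothesis fB : forall m c, bdry D m (f m.+1 c) = f m (bdry C m c).

Lemma chain_map_cycle c : c \in @is_cycle R C n -> f n c \in @is_cycle R D n.
Proof.
case: n c => [|m] c //; rewrite !unfold_in fB => /eqP->.
by rewrite linear0.
Qed.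

Definition cycles_map (z : cycles C n) : cycles D n :=
  Submod (chain_map_cycle (valP z)).

Fact cycles_map_is_linear : linear cycles_map.
Proof. by move=> a u v; apply: val_inj; rewrite /= !linearP. Qed.
HB.instance Definition _ :=
  GRing.isLinear.Build R _ _ *:%R cycles_map cycles_map_is_linear.

Lemma cycles_map_boundary z :
  z \in @is_boundary R C n -> cycles_map z \in @is_boundary R D n.
Proof.
move=> /asboolP[c cE]; apply/asboolP; exists (f n.+1 c).
by rewrite fB cE.
Qed.

Definition homology_class (K : chain_complex R) (z : cycles K n) : homology K n :=
  \pi_(quotmod (@is_boundary R K n)) z.
HB.instance Definition _ K := GRing.isLinear.Build R _ _ *:%R
  (@homology_class K) (@pi_quotmod_is_linear R _ (@is_boundary R K n)).

Lemma homology_class_eq K (x y : cycles K n) :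
  (homology_class x == homology_class y) = (x - y \in @is_boundary R K n).
Proof. exact: pi_quotmod_eq. Qed.

Lemma homology_classP K (h : homology K n) : exists z, h = homology_class z.
Proof.
by exists (repr (h : quotmod (@is_boundary R K n))); rewrite /homology_class reprK.
Qed.

(** Evaluated on a chosen representative; [homology_map_class] shows that the choice does not
    matter, because chain maps send boundaries to boundaries. *)
Definition homology_map (h : homology C n) : homology D n :=
  homology_class (cycles_map (repr (h : quotmod (@is_boundary R C n)))).

Lemma homology_map_class z :
  homology_map (homology_class z) = homology_class (cycles_map z).
Proof.
apply/eqP; rewrite homology_class_eq -linearB cycles_map_boundary //.
exact: repr_quotmodB.
Qed.

Fact homology_map_is_linear : linear homology_map.
Proof.
move=> a u v; have [x ->] := homology_classP u; have [y ->] := homology_classP v.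
by rewrite -linearP !homology_map_class !linearP.
Qed.
HB.instance Definition _ :=
  GRing.isLinear.Build R _ _ *:%R homology_map homology_map_is_linear.

(** Moves the problem from quotients to chains: the first condition is surjectivity on classes; the
    second, that a cycle bounds as soon as its image does, is injectivity. *)
Lemma lmod_isomorphic_homology :
    (forall d, d \in @is_cycle R D n ->
       exists2 c, c \in @is_cycle R C n & exists b, bdry D n b = f n c - d) ->
    (forall c b, c \in @is_cycle R C n -> bdry D n b = f n c ->
       exists a, bdry C n a = c) ->
  lmod_isomorphic (homology C n) (homology D n).
Proof.
move=> surj inj; exists homology_map.
have hsurj y : exists x, homology_map x == y.
  have [d ->] := homology_classP y; have [c cC [b bE]] := surj _ (valP d).
  exists (homology_class (Submod cC)).
  by rewrite homology_map_class homology_class_eq; apply/asboolP; exists b.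
have hinj : injective homology_map.
  move=> u v; have [x ->] := homology_classP u; have [y ->] := homology_classP v.
  rewrite !homology_map_class => /eqP.
  rewrite homology_class_eq -linearB => /asboolP[b bE].
  apply/eqP; rewrite homology_class_eq; apply/asboolP.
  exact: inj (valP _) bE.
(* The inverse selects preimages by [xchoose], which is why [hsurj] uses the boolean [==]. *)
exists (fun y => xchoose (hsurj y)) => [x|y]; last exact/eqP/(xchooseP (hsurj y)).
exact/hinj/eqP/(xchooseP (hsurj _)).
Qed.

End QuasiIsomorphism.

(** * Free modules: restriction to a sub-basis and extension by zero *)

Section FreeModules.
Variables (R : comPzRingType) (T : finType).

Lemma lin_ext_id (v : free_mod R T) : lin_ext (@basis R T) v = v.
Proof.
apply/ffunP => x; rewrite /lin_ext sum_ffunE (bigD1 x) //= big1.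
  by rewrite !ffunE eqxx addr0 [LHS]mulr1.
by move=> y yx; rewrite !ffunE eq_sym (negPf yx) scaler0.
Qed.

Lemma free_mod_linear_eq (M : lmodType R) (f g : {linear free_mod R T -> M}) :
  (forall x, f (basis R x) = g (basis R x)) -> f =1 g.
Proof.
move=> fg v; rewrite -[v]lin_ext_id /lin_ext !linear_sum.
by apply: eq_bigr => x _; rewrite !linearZ fg.
Qed.

Lemma linear_span_of (M : lmodType R) (f : {linear free_mod R T -> M})
    (Q : submodClosed M) (P : pred T) v :
  (forall x, P x -> f (basis R x) \in Q) -> v \in span_of P -> f v \in Q.
Proof.
move=> PQ /asboolP[c ->]; rewrite linear_sum rpred_sum // => x Px.
by rewrite linearZ rpredZ ?PQ.
Qed.

Lemma basis_span (P : pred T) x : P x -> basis R x \in span_of P.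
Proof.
move=> Px; apply/span_ofP => y nPy; rewrite ffunE.
by case: eqP => // yx; rewrite yx Px in nPy.
Qed.

Lemma span_of_sub (P Q : pred T) (v : free_mod R T) :
  subpred P Q -> v \in span_of P -> v \in span_of Q.
Proof.
by move=> PQ /span_ofP vP; apply/span_ofP => x nQ; apply/vP/(contra (PQ x)).
Qed.

Variable P : pred T.
Local Notation S := {x : T | P x}.

Definition restrict (v : free_mod R T) : free_mod R S := [ffun x => v (val x)].

Fact restrict_is_linear : linear restrict.
Proof. by move=> a u v; apply/ffunP => x; rewrite !ffunE. Qed.
HB.instance Definition _ :=
  GRing.isLinear.Build R _ _ *:%R restrict restrict_is_linear.

Definition extend0 (v : free_mod R S) : free_mod R T :=
  [ffun t => oapp v 0 (insub t)].

Fact extend0_is_linear : linear extend0.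
Proof.
move=> a u v; apply/ffunP => t; rewrite !ffunE.
by case: insub => [x|] /=; rewrite ?ffunE ?scaler0 ?addr0.
Qed.
HB.instance Definition _ :=
  GRing.isLinear.Build R _ _ *:%R extend0 extend0_is_linear.

Lemma extend0K : cancel extend0 restrict.
Proof. by move=> v; apply/ffunP => x; rewrite !ffunE valK. Qed.

Lemma extend0_span v : extend0 v \in span_of P.
Proof. by apply/span_ofP => t nPt; rewrite ffunE insubF ?(negPf nPt). Qed.

Lemma restrictK v : v \in span_of P -> extend0 (restrict v) = v.
Proof.
move=> /span_ofP vP; apply/ffunP => t; rewrite ffunE.
by case: insubP => [x _ <-|/vP->] //=; rewrite ffunE.
Qed.

(** Killing basis elements outside [P] is the convention for discarded faces, so boundaries of cell
    complexes can be computed in [Lambda] and then restricted. *)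
Lemma restrict_basis t : restrict (basis R t) = basis_or0 R (insub t).
Proof.
apply/ffunP => x; rewrite ffunE; case: insubP => [y _ <-|nPt] /=.
  by rewrite !ffunE (inj_eq val_inj).
rewrite !ffunE; case: eqP => // xt.
by rewrite -xt (valP x) in nPt.
Qed.

Lemma extend0_basis x : extend0 (basis R x) = basis R (val x).
Proof.
apply/ffunP => t; rewrite !ffunE; case: insubP => [y _ <-|nPt] /=.
  by rewrite ffunE (inj_eq val_inj).
by case: eqP => // tx; rewrite tx (valP x) in nPt.
Qed.

End FreeModules.

(** * Lengths of words and the length filtration *)

Section Length.
Variables (V : finType) (E : rel V).
Implicit Types (x y : V) (s : seq V).

Lemma dist_isSome x y : isSome (dist E x y) = connect E x y.
Proof.
apply/idP/idP.
  case d: dist => [a|] // _; have [/walkP[p _ [xp yE]] _] := (distP _ _ _ _).1 d.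
  by apply/connectP; exists p.
by case/connect_walk=> n /dist_walk[d ->].
Qed.

Lemma dist_gt0 x y a : x != y -> dist E x y = Some a -> (0 < a)%N.
Proof.
case: a => // xy /distP[/walkP[[|//] _ [_ /= yE]] _].
by rewrite yE eqxx in xy.
Qed.

Lemma dist_eq1 x y : x != y -> (dist E x y == Some 1%N) = E x y.
Proof.
move=> xy; apply/eqP/idP.
  by case/distP=> /walkP[[|z [|//]] //= _ [/andP[xz _] <-]].
move=> Exy; have [|d dE d1] := @dist_walk _ E 1 x y.
  by apply/walkP; exists [:: y]; rewrite //= Exy.
have := dist_gt0 xy dE; rewrite dE.
by case: d d1 {dE} => [|[|]].
Qed.

(** Finite length only asks for paths between consecutive letters; transitivity of [connect] extends
    this to all pairs. *)
Lemma len_isSome s : isSome (len E s) = pairwise (connect E) s.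
Proof.
rewrite -sorted_pairwise; last exact: connect_trans.
elim: s => [|x [|y s] IH] //.
rewrite [RHS]/= -dist_isSome -[path _ y s]/(sorted (connect E) (y :: s)) -IH.
change (len E [:: x, y & s]) with (if (dist E x y, len E (y :: s)) is
  (Some a, Some b) then Some (a + b)%N else None).
by case: dist => [a|]; case: len.
Qed.

Lemma len_ge_size x s m :
  uniq (x :: s) -> len E (x :: s) = Some m -> (size s <= m)%N.
Proof.
elim: s x m => [|y s IH] x m // /andP[xs us] /len_cons[a [b [xy ys ->]]].
rewrite inE negb_or in xs; case/andP: xs => xNy _.
by rewrite /= -add1n leq_add ?(dist_gt0 xNy xy) ?(IH y).
Qed.

(** Distinct letters make each of the [size s] distances at least 1, so equality forces every step
    to be an edge. *)
Lemma len_eq_size x s :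
  uniq (x :: s) -> (len E (x :: s) == Some (size s)) = path E x s.
Proof.
elim: s x => [|y s IH] x // /andP[xs us].
rewrite inE negb_or in xs; case/andP: xs => xNy _.
rewrite [RHS]/= -IH // -dist_eq1 //.
apply/eqP/andP=> [/len_cons[a [b [xy ys abE]]]|[/eqP xy /eqP ys]].
  have a0 := dist_gt0 xNy xy; have sb := len_ge_size us ys.
  suff [a1 bE] : a = 1%N /\ b = size s by rewrite xy ys a1 bE.
  move: abE; rewrite /= -add1n => abE.
  (* From [a + b = 1 + size s] and [size s <= b] follows [a <= 1]. *)
  have a1 : a = 1%N.
    apply/eqP; rewrite eqn_leq a0 andbT -(leq_add2r (size s)).
    by rewrite abE leq_add2l.
  by split=> //; move: abE; rewrite a1 => /addnI->.
change (len E [:: x, y & s]) with (if (dist E x y, len E (y :: s)) is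
  (Some a, Some b) then Some (a + b)%N else None).
by rewrite xy ys.
Qed.

Lemma len_behead x s m : (0 < size s)%N -> uniq (x :: s) ->
  len E (x :: s) = Some m -> exists2 m', len E s = Some m' & (m' < m)%N.
Proof.
case: s => // y s _ /andP[xs us] /len_cons[a [b [xy ys ->]]].
rewrite inE negb_or in xs; case/andP: xs => xNy _.
by exists b; rewrite // -add1n leq_add2r (dist_gt0 xNy xy).
Qed.

Lemma len_rcons_lt x s y m : uniq (x :: rcons s y) ->
  len E (x :: rcons s y) = Some m ->
  exists2 m', len E (x :: s) = Some m' & (m' < m)%N.
Proof.
elim: s x m => [|z s IH] x m /andP[xs us] /len_cons[a [b [xz zs ->]]].
  rewrite inE in xs; exists 0%N => //.
  by rewrite ltn_addr // (dist_gt0 xs xz).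
have [b' zs' bb'] := IH z b us zs.
exists (a + b')%N; last by rewrite ltn_add2l.
by move: zs'; rewrite /= xz => ->.
Qed.

(** The non-interior indices are the two ends; deleting an end letter removes one summand of the
    length, positive because the letters are distinct. *)
Lemma len_rm_end n (t : n.+2.-tuple V) (i : 'I_n.+2) m :
    ~~ interior_idx i -> uniq t -> len E t = Some m ->
  exists2 m', len E (rm i t) = Some m' & (m' < m)%N.
Proof.
rewrite /interior_idx negb_and -leqNgt leqn0 -leqNgt => /orP[/eqP->|ni] ut lt.
  case: t ut lt => -[|x s] //= /eqP[ss] ut lt.
  by rewrite /rm take0 drop1; apply: len_behead ut lt; rewrite ss.
have -> : nat_of_ord i = n.+1.
  by apply/eqP; rewrite eqn_leq ni andbT -ltnS.
rewrite /rm drop_oversize ?size_tuple // cats0.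
case: t ut lt => -[|x s] //= /eqP[]; case/lastP: s => // s y.
rewrite size_rcons => -[<-] ut lt.
rewrite -cats1 take_size_cat //; exact: len_rcons_lt ut lt.
Qed.

(** A level of the length filtration. The bound is strict, so levels [l] and [l.+1] differ exactly
    by the words of length [l]; infinite length is excluded by the default [false]. *)
Definition word_lt l n (t : n.+1.-tuple V) : bool :=
  uniq t && oapp (ltn^~ l) false (len E t).

Lemma word_lt_inj_word l n : subpred (@word_lt l n) (@inj_word V E n).
Proof.
move=> t /andP[ut]; rewrite /inj_word ut -len_isSome.
by case: len.
Qed.

Lemma word_lt_leq l l' n : (l <= l')%N -> subpred (@word_lt l n) (@word_lt l' n).
Proof.
move=> ll' t /andP[ut]; rewrite /word_lt ut.
by case: len => //= m ml; apply: leq_trans ml ll'.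
Qed.

(** The filtration is exhaustive in each degree, as there are finitely many words of a given
    degree. *)
Lemma inj_word_lt n :
  exists l, subpred (@inj_word V E n) (@word_lt l n).
Proof.
exists (\max_(t : n.+1.-tuple V) odflt 0%N (len E t)).+1 => t.
rewrite /inj_word /word_lt -len_isSome => /andP[->].
case lt : len => [m|] //= _.
by rewrite ltnS (leq_trans _ (leq_bigmax t)) // lt.
Qed.

Lemma word_lt_del l n (t : n.+2.-tuple V) i : word_lt l t -> word_lt l (del i t).
Proof.
case/andP=> ut; rewrite /word_lt val_del (subseq_uniq (subseq_rm i t) ut).
case lt: len => [m|] //= ml; have [m' -> m'm] := len_rm i lt.
exact: leq_ltn_trans ml.
Qed.

Lemma inj_word_del n (t : n.+2.-tuple V) i :
  inj_word E t -> inj_word E (del i t).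
Proof.
case/andP=> ut ct; rewrite /inj_word val_del (subseq_uniq (subseq_rm i t) ut).
exact: subseq_pairwise (subseq_rm i t) ct.
Qed.

Lemma word_ltS l n (t : n.+1.-tuple V) :
  word_lt l.+1 t = word_lt l t || emc_cell E l t.
Proof.
rewrite /word_lt /emc_cell -andb_orr; congr (_ && _).
case: len => //= m; rewrite ltnS leq_eqVlt orbC.
by congr (_ || _); apply/eqP/eqP => [->|[]].
Qed.

Lemma emc_cell_word_lt l n (t : n.+1.-tuple V) : emc_cell E l t -> ~~ word_lt l t.
Proof.
by case/andP=> ut /eqP lt; rewrite /word_lt ut lt /= ltnn.
Qed.

(** Explains why summing over interior indices only, as [EMC] does, agrees with the full boundary on
    the graded piece. *)
Lemma emc_cell_del_end l n (t : n.+2.-tuple V) i :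
  ~~ interior_idx i -> emc_cell E l t -> ~~ emc_cell E l (del i t).
Proof.
move=> Ii /andP[ut /eqP lt]; have [m' m'E m'l] := len_rm_end Ii ut lt.
rewrite /emc_cell val_del m'E negb_and orbC.
by apply/orP; left; apply: contraTneq m'l => -[->]; rewrite ltnn.
Qed.

(** A word of [n.+1] distinct letters has length at least [n], so the bound [n.+1] leaves only
    length [n], where every step is an edge. *)
Lemma word_lt_allowed n :
  @word_lt n.+1 n =1 @strongly_regular_allowed V E n.
Proof.
move=> t; rewrite /word_lt /strongly_regular_allowed.
case: (boolP (uniq t)) => //=.
case: t => -[|x s] // /[dup] /eqP[sn] st ut.
rewrite -[sorted E _]/(path E x s) -(len_eq_size ut) sn.
rewrite -[tval (Tuple st)]/(x :: s); have := fun m => @len_ge_size x s m ut.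
case: len => [m|] //= /(_ m erefl); rewrite sn => nm.
by rewrite ltnS -[RHS]/(m == n) eqn_leq nm andbT.
Qed.

End Length.

(** * Comparison of [Omega] and [Inj] inside [Lambda] *)

Section Comparison.
Variables (R : comPzRingType) (V : finType) (E : rel V).
Local Notation L := (Lambda R V).
Local Notation Inj := (Inj_complex R E).
Local Notation lt l n := (@span_of R _ (@word_lt V E l n)).
Local Notation inj n := (@span_of R _ (@inj_word V E n)).

Lemma bdry_basis n (t : n.+2.-tuple V) :
  bdry L n (basis R t) = \sum_(i < n.+2) (-1) ^+ i *: basis R (del i t).
Proof. exact: alt_bdryE. Qed.

Lemma bdry_span (P : forall n, pred (n.+1.-tuple V)) n (v : L n.+1) :
    (forall (t : n.+2.-tuple V) i, P n.+1 t -> P n (del i t)) ->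
  v \in span_of (@P n.+1) -> bdry L n v \in span_of (@P n).
Proof.
move=> Pdel; apply: (linear_span_of (f := bdry L n)) => t Pt.
rewrite bdry_basis rpred_sum // => i _.
by rewrite rpredZ // basis_span // Pdel.
Qed.

Lemma extend0_bdry n (v : Inj n.+1) :
  extend0 (bdry Inj n v) = bdry L n (extend0 v).
Proof.
apply: (free_mod_linear_eq (f := @extend0 R _ _ \o bdry Inj n)
  (g := bdry L n \o @extend0 R _ _)) => x /=.
rewrite extend0_basis bdry_basis [X in extend0 X]alt_bdryE linear_sum.
apply: eq_bigr => i _; rewrite linearZ /= /rface /= /cell_face.
by rewrite insubT ?inj_word_del ?(valP x) // => Px; rewrite /= extend0_basis.
Qed.

Lemma restrict_bdry n (v : L n.+1) : v \in inj n.+1 ->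
  restrict (inj_word E (n := n)) (bdry L n v) = bdry Inj n (restrict _ v).
Proof. by move=> vI; rewrite -{1}(restrictK vI) -extend0_bdry extend0K. Qed.

(** Identifies [EMC] with the graded piece: the end faces present in [Lambda] are shorter than [l]
    and vanish under [restrict]. *)
Lemma EMC_bdryE l n (v : EMC R E l n.+1) :
  bdry (EMC R E l) n v = restrict (emc_cell E l (n := n)) (bdry L n (extend0 v)).
Proof.
apply: (free_mod_linear_eq (f := bdry (EMC R E l) n)
  (g := @restrict R _ _ \o bdry L n \o @extend0 R _ _)) => x /=.
rewrite extend0_basis bdry_basis [LHS]alt_bdryE linear_sum.
apply: eq_bigr => i _; rewrite linearZ /= restrict_basis /rface.
case: ifP => // /negbT Ii; rewrite insubF //.
exact/negbTE/(emc_cell_del_end Ii (valP x)).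
Qed.

Lemma restrict_lt l n (v : L n) :
  v \in lt l n -> restrict (emc_cell E l (n := n)) v = 0.
Proof.
move=> /span_ofP v0; apply/ffunP => x; rewrite !ffunE v0 //.
exact/emc_cell_word_lt/(valP x).
Qed.

Lemma lt_restrict0 l n (v : L n) :
  v \in lt l.+1 n -> restrict (emc_cell E l (n := n)) v = 0 -> v \in lt l n.
Proof.
move=> /span_ofP vS v0; apply/span_ofP => t nt.
have [et|net] := boolP (emc_cell E l t).
  by move/ffunP: v0 => /(_ (exist _ t et)); rewrite !ffunE.
by rewrite vS // word_ltS negb_or nt.
Qed.

(** The boundary half of membership in [Omega], kept apart because subtracting a boundary preserves
    it. *)
Definition short_bdry n : {pred L n} :=
  match n return {pred L n} with
  | 0 => fun _ => true
  | m.+1 => fun v => bdry L m v \in lt m.+1 m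
  end.

Lemma short_bdryB n (v : L n) b : v \in @short_bdry n ->
  v - bdry L n b \in @short_bdry n.
Proof. by case: n v b => // n v b; rewrite !unfold_in linearB bdry_bdry subr0. Qed.

Lemma Omega_regE n (v : L n) :
  (v \in @Omega_reg R V E n) = (v \in lt n.+1 n) && (v \in @short_bdry n).
Proof.
have AE m (u : L m) : (u \in @A_reg R V E m) = (u \in lt m.+1 m).
  by apply/idP/idP; apply: span_of_sub => t; rewrite word_lt_allowed.
case: n v => [|n] v.
  by rewrite -[LHS]/(v \in @A_reg R V E 0) AE andbT.
rewrite -[LHS]/((v \in @A_reg R V E n.+1) && (bdry L n v \in @A_reg R V E n)).
by rewrite !AE.
Qed.

Lemma truncation_lt l n (v : L n) : v \in lt l.+1 n ->
  v - extend0 (restrict (emc_cell E l (n := n)) v) \in lt l n.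
Proof.
move=> vl; apply: lt_restrict0; last by rewrite linearB /= extend0K subrr.
rewrite rpredB // (span_of_sub _ (extend0_span _)) // => t et.
by rewrite word_ltS et orbT.
Qed.

(** The length-[l] part of [v] differs from [v] by shorter words, whose boundary stays shorter, and
    the boundary of [v] is itself short; nothing of length [l] survives. *)
Lemma restrict_cycle l n (v : L n) :
    (n < l)%N -> v \in lt l.+1 n -> v \in @short_bdry n ->
  restrict (emc_cell E l (n := n)) v \in @is_cycle R (EMC R E l) n.
Proof.
case: n v => [|n] v // nl vl sv; rewrite unfold_in EMC_bdryE.
set w := extend0 _; have -> : w = v - (v - w) by rewrite opprB addrCA subrr addr0.
rewrite [bdry L n _]linearB [restrict _ _]linearB /= !restrict_lt ?subr0 //.
  by apply: bdry_span (truncation_lt vl) => t i; apply: word_lt_del.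
by apply: span_of_sub sv; apply: word_lt_leq; apply: ltnW.
Qed.

Hypothesis diag : regularly_diagonal R E.

(** Diagonality in bidegree [(n, l)] makes the length-[l] part of [v] an [EMC] boundary; subtracting
    the full boundary of a bounding chain cancels that part and adds only shorter words. *)
Lemma shorten n l (v : L n) :
    (n < l)%N -> v \in lt l.+1 n -> v \in @short_bdry n ->
  exists2 b : L n.+1, b \in inj n.+1 & v - bdry L n b \in lt l n.
Proof.
move=> nl vl sv; pose z : cycles (EMC R E l) n := Submod (restrict_cycle nl vl sv).
have nNl : n <> l by apply/eqP; rewrite neq_ltn nl.
have /eqP := diag nNl (homology_class z); rewrite -(linear0 (@homology_class R n _)).
rewrite homology_class_eq subr0 => /asboolP[b bE].
have cell_lt m (t : m.+1.-tuple V) : emc_cell E l t -> word_lt E l.+1 t.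
  by move=> et; rewrite word_ltS et orbT.
exists (extend0 b).
  apply: span_of_sub (extend0_span b) => t /cell_lt; exact: word_lt_inj_word.
apply: lt_restrict0; last first.
  by rewrite linearB /= -[X in _ - X]EMC_bdryE bE subrr.
rewrite rpredB // bdry_span // => [t i|]; first exact: word_lt_del.
by apply: span_of_sub (extend0_span b) => t; apply: cell_lt.
Qed.

Lemma homologous_Omega n (v : L n) : v \in inj n -> v \in @short_bdry n ->
  exists2 b : L n.+1, b \in inj n.+1 & v - bdry L n b \in @Omega_reg R V E n.
Proof.
have [l injl] := inj_word_lt E n => /(span_of_sub injl) {injl}.
have [ln vl sv|] := leqP l n.+1.
  exists 0; rewrite ?rpred0 // linear0 subr0 Omega_regE sv andbT.
  exact: span_of_sub (word_lt_leq _) vl.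
(* Descent on the length bound, one [shorten] at a time, until it reaches [n.+1], where the chain is
   allowed. *)
elim: l v => // l IH v nl vl sv.
have [b bI vb] := @shorten n l v nl vl sv; have sb := short_bdryB b sv.
have [ln|ln] := ltnP n.+1 l.
  have [c cI vbc] := IH _ ln vb sb.
  by exists (b + c); [exact: rpredD | rewrite linearD opprD addrA].
exists b => //; rewrite Omega_regE sb andbT.
exact: span_of_sub (word_lt_leq _) vb.
Qed.

(** The inclusion: by [Omega_inj], restricting loses no coefficient. *)
Definition Omega_to_Inj n (v : Omega R E n) : Inj n :=
  restrict (inj_word E (n := n)) (val v).

Fact Omega_to_Inj_is_linear n : linear (@Omega_to_Inj n).
Proof. by move=> a u v; rewrite /Omega_to_Inj /= !linearP. Qed.
HB.instance Definition _ n := GRing.isLinear.Build R (Omega R E n) (Inj n) *:%R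
  (@Omega_to_Inj n) (@Omega_to_Inj_is_linear n).

Lemma Omega_inj n (v : Omega R E n) : val v \in inj n.
Proof.
have := valP v; rewrite Omega_regE => /andP[vl _].
exact: span_of_sub (@word_lt_inj_word _ _ _ _) vl.
Qed.

Lemma Omega_to_Inj_bdry n (v : Omega_complex R E n.+1) :
  bdry Inj n (Omega_to_Inj v) = Omega_to_Inj (bdry (Omega_complex R E) n v).
Proof. by rewrite /Omega_to_Inj -restrict_bdry ?Omega_inj. Qed.

Lemma Omega_Inj_homology n :
  lmod_isomorphic (homology (Omega_complex R E) n) (homology Inj n).
Proof.
apply: (@lmod_isomorphic_homology R (Omega_complex R E) Inj n
  (fun m => @Omega_to_Inj m) Omega_to_Inj_bdry) => [d dC|c b cC bE].
  (* Surjectivity: a cycle has zero, hence short, boundary, so it can be moved into [Omega]. *)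
  have sd : extend0 d \in @short_bdry n.
    case: n d dC => [|n] d // /eqP dC.
    by rewrite unfold_in -extend0_bdry dC linear0 rpred0.
  have [b bI cO] := homologous_Omega (extend0_span d) sd.
  exists (Submod cO : Omega_complex R E n).
    case: n d dC sd b bI cO => [|n] d // /eqP dC sd b bI cO.
    rewrite unfold_in; apply/eqP/val_inj.
    rewrite -[LHS]/(bdry L n (extend0 d - bdry L n.+1 b)) linearB bdry_bdry.
    by rewrite -extend0_bdry dC linear0 subr0.
  exists (- restrict (inj_word E (n := n.+1)) b).
  have fE : Omega_to_Inj (Submod cO) = d - bdry Inj n (restrict _ b).
    by rewrite -restrict_bdry // /Omega_to_Inj [LHS]linearB /= extend0K.
  by rewrite -[RHS]/(Omega_to_Inj (Submod cO) - d) fE linearN addrAC subrr add0r.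
(* Injectivity: the boundary of [b] is [c], short because [c] lies in [Omega]; so [b] can be moved
   into [Omega] in degree [n.+1] by subtracting a boundary, which leaves its own boundary
   unchanged. *)
have bdE : bdry L n (extend0 b) = val c.
  by rewrite -extend0_bdry bE /Omega_to_Inj restrictK ?Omega_inj.
have sb : extend0 b \in @short_bdry n.+1.
  by rewrite unfold_in bdE; have := valP c; rewrite Omega_regE => /andP[].
have [a aI aO] := homologous_Omega (extend0_span b) sb.
exists (Submod aO); apply: val_inj.
rewrite -[LHS]/(bdry L n (extend0 b - bdry L n.+1 a)) linearB bdry_bdry.
by rewrite subr0.
Qed.

End Comparison.

Theorem proposition5p17 (R : comPzRingType) (V : finType) (E : rel V)
    (conn : connected_digraph E) (diag : regularly_diagonal R E) (k : nat) :
  lmod_isomorphic (homology (Omega_complex R E) k)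
                  (homology (Inj_complex R E) k).
Proof. exact: Omega_Inj_homology. Qed.
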